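(* Let $f\in C([0,1]^n)$ be nonnegative, and for each $h>0$ let $v_h$ denote the maximal solution of the scheme (S2). Then $v_h\to v$ uniformly on $[0,1]^n$ as $h\to0$, where $v$ is the maximal viscosity solution of (P2); that is, $\max_{x\in[0,1]^n_h}|v_h(x)-v(x)|\to0$ as $h\to0$.
   Context: $n\ge1$ is an integer, $a_+=\max(a,0)$, and $\Gamma=\partial[0,1]^n\setminus(0,1]^n$. A function is nondecreasing if it is nondecreasing in each coordinate separately. Grid: for $h>0$, $\mathbb{Z}_h=\{hk:k\in\mathbb{Z}\}$, $\Omega_h=\Omega\cap(\mathbb{Z}_h)^n$, and $D_i^-g(x)=\dfrac{g(x)-g(x-he_i)}{h}$. Problem (P1): $(u_{x_1})_+\cdots(u_{x_n})_+=f$ in $(0,1]^n$, $u=0$ on $\Gamma$. A viscosity solution of (P1) is a continuous $u:[0,1]^n\to\mathbb{R}$ with $u=0$ on $\Gamma$ such that for every $x_0\in(0,1]^n$ and every $C^1$ function $\phi$: if $u-\phi$ has a local maximum (resp. minimum) at $x_0$ relative to $(0,1]^n$, then $\prod_i(\phi_{x_i}(x_0))_+\le f(x_0)$ (resp. $\ge f(x_0)$). For continuous nonnegative $f$ there is a unique nondecreasing viscosity solution $u$ of (P1). Problem (P2): $(v_{x_1})_+\cdots(v_{x_n})_+=v^{n-1}f$ in $(0,1]^n$, $v=0$ on $\Gamma$. The maximal viscosity solution of (P2) is by definition $v=u^n/n^n$, where $u$ is the nondecreasing viscosity solution of (P1). Scheme (S2): $(D_1^-v_h(x))_+\cdots(D_n^-v_h(x))_+=v_h(x)^{n-1}f(x)$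 for $x\in(0,1]^n_h$, $v_h(x)=0$ for $x\in\Gamma_h$. The maximal solution $v_h$ is defined inductively: at each $x\in(0,1]^n_h$, given $v_h(x-he_1),\dots,v_h(x-he_n)$, the value $v_h(x)$ is the largest real number satisfying the equation at $x$. *)

(* Defs.v *)
From mathcomp Require Import all_boot all_order all_algebra.
From mathcomp Require Import all_classical all_reals all_analysis.

Set Implicit Arguments.
Unset Strict Implicit.
Unset Printing Implicit Defensive.

Import Order.TTheory GRing.Theory Num.Theory.
Import numFieldNormedType.Exports.

Local Open Scope classical_set_scope.
Local Open Scope ring_scope.

(* Points of R^n are row vectors.  Functions on [0,1]^n (resp. on a grid) are
   total functions on 'rV[R]_n; only their values on [0,1]^n (resp. on the
   grid points of [0,1]^n) are ever constrained or used. *)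
Section Setting.
Context {R : realType} {n : nat}.
Implicit Types (f g u v phi : 'rV[R]_n -> R) (x y : 'rV[R]_n) (h t : R).

Definition pospart (a : R) : R := Num.max a 0.

Definition basis_vec (i : 'I_n) : 'rV[R]_n := delta_mx 0 i.

Definition unit_cube : set 'rV[R]_n := [set x | forall i, 0 <= x 0 i <= 1].

Definition half_open_cube : set 'rV[R]_n := [set x | forall i, 0 < x 0 i <= 1].

Definition Gamma : set 'rV[R]_n :=
  (closure unit_cube `\` interior unit_cube) `\` half_open_cube.

Definition nondecreasing_on_cube u : Prop :=
  forall x y (i : 'I_n), unit_cube x -> unit_cube y ->
    (forall j, j != i -> x 0 j = y 0 j) -> x 0 i <= y 0 i -> u x <= u y.

Definition C1 phi : Prop :=
  (forall x, differentiable phi x) /\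
  (forall i : 'I_n, continuous (fun x => 'D_(basis_vec i) phi x)).

Definition local_max_rel (A : set 'rV[R]_n) g x0 : Prop :=
  \forall y \near within A (nbhs x0), g y <= g x0.

Definition local_min_rel (A : set 'rV[R]_n) g x0 : Prop :=
  \forall y \near within A (nbhs x0), g x0 <= g y.

Definition P1_operator phi x : R :=
  \prod_(i < n) pospart ('D_(basis_vec i) phi x).

Definition P1_viscosity_solution f u : Prop :=
  [/\ {within unit_cube, continuous u},
      (forall x, Gamma x -> u x = 0) &
      forall x0 phi, half_open_cube x0 -> C1 phi ->
        (local_max_rel half_open_cube (fun y => u y - phi y) x0 ->
           P1_operator phi x0 <= f x0) /\
        (local_min_rel half_open_cube (fun y => u y - phi y) x0 ->
           f x0 <= P1_operator phi x0)].

Definition P2_maximal_viscosity_solution f v : Prop :=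
  exists u, [/\ P1_viscosity_solution f u, nondecreasing_on_cube u &
    forall x, unit_cube x -> v x = u x ^+ n / n%:R ^+ n].

Definition lattice h : set 'rV[R]_n :=
  [set x | forall i, exists k : int, x 0 i = h * k%:~R].

Definition backward_diff h (i : 'I_n) g x : R :=
  (g x - g (x - h *: basis_vec i)) / h.

Definition S2_equation f h g x : Prop :=
  \prod_(i < n) pospart (backward_diff h i g x) = g x ^+ n.-1 * f x.

(* [eta g with x |-> t] keeps the neighbouring values g (x - h e_i) and
   replaces the value at x by t, so the last clause says that g x is the
   largest root of the equation at x given these neighbouring values. *)
Definition S2_maximal_solution f h g : Prop :=
  (forall x, (Gamma `&` lattice h) x -> g x = 0) /\
  (forall x, (half_open_cube `&` lattice h) x ->
     S2_equation f h g x /\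
     forall t, S2_equation f h [eta g with x |-> t] x -> t <= g x).

(* The grid in [0,1]^n is finite and nonempty for h > 0, so this supremum is
   the maximum over the grid. *)
Definition grid_error h g v : R :=
  sup [set `|g x - v x| | x in unit_cube `&` lattice h].

End Setting.

(* Main.v *)
Require Import Defs.
From mathcomp Require Import all_boot all_order all_algebra.
From mathcomp Require Import all_classical all_reals all_analysis.
From mathcomp Require Import ring lra.

(** Write [v = (u / n)^n] and let [w = n * v_h^(1/n)], so that the claim is that
    [w] converges to [u] uniformly on the grid.

    The substitution removes the factor [v^(n-1)]: by the mean value theorem
    the differences of [v_h = (w / n)^n], divided by [v_h^((n-1)/n)], are at most the
    differences of [w], and are close to them when [w] is bounded away from 0 and
    [h] is small.  Hence [w] is a discrete supersolution of
    [\prod_i (D_i w)_+ = f] everywhere ([root_scheme_supersolution]), and an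
    approximate subsolution where it is not small
    ([root_scheme_subsolution]).

    The two one-sided estimates [scheme_le_viscosity] and [viscosity_le_scheme] are
    comparison arguments that double the variables between a grid point and a
    point of the cube.  The operator is degenerate and does not depend on the
    unknown, so strictness has to be created: adding
    [e * \sum_i x_i] to a nondecreasing supersolution raises the operator by
    at least [e^n] ([prod_add_ge]).  At a maximum of the doubled function the two
    equations are tested with the same gradient up to [O(h)].  They then
    contradict each other once [h] is small and the two points are so close
    that [f] varies by less than [e^n / 2].

    The maximum cannot lie on [Gamma].  The subsolution exceeds the
    supersolution by [s > 0] there and is therefore at least [s], whereas near [Gamma] it
    is small: for [u] this is uniform continuity, and for the scheme it is the
    explicit barrier [v_h <= M * \prod_i x_i] ([S2_sol_le_prod]), which holds
    because [M * \prod_i x_i] is an exact solution of the scheme for constant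
    [f = M].  The bound of [u - w] uses the scheme as a supersolution and thus
    needs no lower bound on [w]; in the bound of [w - u] the scheme is the
    subsolution, and there [w >= s] at the maximum, which is what
    [root_scheme_subsolution] asks for. *)

Set Implicit Arguments.
Unset Strict Implicit.
Unset Printing Implicit Defensive.

Import Order.TTheory GRing.Theory Num.Theory.
Import numFieldNormedType.Exports.

Local Open Scope classical_set_scope.
Local Open Scope ring_scope.

(** * Elementary inequalities *)

(** This is what makes the supersolution strict: adding [e] to every partial
    derivative of a nondecreasing function raises the operator by at least
    [e ^+ n], even where the operator vanishes. *)
Lemma prod_add_ge (R : realFieldType) (n : nat) (a : 'I_n -> R) (e : R) :
  (1 <= n)%N -> 0 <= e -> (forall i, 0 <= a i) ->
  \prod_(i < n) a i + e ^+ n <= \prod_(i < n) (a i + e).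
Proof.
move=> n1 e0; case: n n1 a => // n _; elim: n => [|n IH] a a0.
  by rewrite !big_ord1 expr1.
rewrite big_ord_recr [leRHS]big_ord_recr /=.
have an := a0 ord_max.
have P0 : 0 <= \prod_(i < n.+1) a (widen_ord (leqnSn n.+1) i).
  by apply: prodr_ge0 => i _.
have := IH (fun i => a (widen_ord (leqnSn n.+1) i)) (fun i => a0 _).
set P := \prod_(i < n.+1) a _ in P0 *; set Q := \prod_(i < n.+1) _.
move=> PQ; have en : 0 <= e ^+ n.+1 by rewrite exprn_ge0.
rewrite exprSr; apply: le_trans (_ : (P + e ^+ n.+1) * (a ord_max + e) <= _).
  by rewrite mulrDl !mulrDr; nra.
by rewrite ler_wpM2r // addr_ge0.
Qed.

Lemma bernoulli_ge (R : realFieldType) (c : R) (k : nat) :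
  0 <= c <= 1 -> 1 - k%:R * c <= (1 - c) ^+ k.
Proof.
move=> c01; elim: k => [|k IH]; first by rewrite mul0r subr0 expr0.
rewrite exprS -natr1.
apply: le_trans (_ : (1 - c) * (1 - k%:R * c) <= _); last by rewrite ler_wpM2l//; lra.
by have : 0 <= k%:R :> R by []; nra.
Qed.

Lemma prod_scale_le (R : realFieldType) (n : nat) (a b : 'I_n -> R) (c : R) :
  0 <= c -> (forall i, 0 <= b i) -> (forall i, c * b i <= a i) ->
  c ^+ n * \prod_(i < n) b i <= \prod_(i < n) a i.
Proof.
move=> c0 b0 ab; rewrite -[in c ^+ n](card_ord n) -prodr_const -big_split /=.
by apply: ler_prod => i _; rewrite mulr_ge0 // ab.
Qed.

Lemma subrX_le (R : realFieldType) (r s : R) (n : nat) :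
  0 <= s <= r -> r ^+ n - s ^+ n <= n%:R * r ^+ n.-1 * (r - s).
Proof.
move=> /andP[s0 sr]; have r0 := le_trans s0 sr.
rewrite subrXX mulrC; apply: ler_wpM2r; first by rewrite subr_ge0.
apply: le_trans (_ : \sum_(i < n) r ^+ n.-1 <= _); last first.
  by rewrite sumr_const card_ord mulr_natl.
apply: ler_sum => i _; have le_in : (i <= n.-1)%N by case: n i => [[//]|k i]; rewrite -ltnS.
by rewrite -[in leRHS](subnK le_in) exprD ler_wpM2l ?exprn_ge0 // lerXn2r ?nnegrE.
Qed.

Lemma subrX_ge (R : realFieldType) (r s : R) (n : nat) :
  0 <= s <= r -> n%:R * s ^+ n.-1 * (r - s) <= r ^+ n - s ^+ n.
Proof.
move=> /andP[s0 sr]; have r0 := le_trans s0 sr.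
rewrite subrXX [leRHS]mulrC; apply: ler_wpM2r; first by rewrite subr_ge0.
apply: le_trans (_ : \sum_(i < n) s ^+ n.-1 <= _).
  by rewrite sumr_const card_ord mulr_natl.
apply: ler_sum => i _; have le_in : (i <= n.-1)%N by case: n i => [[//]|k i]; rewrite -ltnS.
by rewrite -[in leLHS](subnK le_in) exprD ler_wpM2r ?exprn_ge0 // lerXn2r ?nnegrE.
Qed.

(** With [g = r ^+ n], the mean value bound [r^n - s^n <= n r^(n-1) (r - s)]
    lets the factor [g ^+ n.-1] cancel against the powers of [r] on the other
    side.  Where [r = 0] nothing can be cancelled; for the maximal solution that
    case is [S2_sol_eq0]. *)
Lemma root_scheme_supersolution (R : realFieldType) (n : nat) (h r f : R) (s : 'I_n -> R) :
  (1 <= n)%N -> 0 < h -> (forall i, 0 <= s i <= r) ->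
  (r = 0 -> f <= 0) -> 
  \prod_(i < n) ((r ^+ n - s i ^+ n) / h) = (r ^+ n) ^+ n.-1 * f ->
  f <= \prod_(i < n) (n%:R * (r - s i) / h).
Proof.
move=> n1 h0 sr f0 E.
have r0 : 0 <= r by have /andP[a b] := sr (Ordinal n1); exact: le_trans b.
have sr' i : 0 <= r - s i by rewrite subr_ge0; case/andP: (sr i).
have P0 : 0 <= \prod_(i < n) (n%:R * (r - s i) / h).
  by apply: prodr_ge0 => i _; rewrite divr_ge0 ?(ltW h0) // mulr_ge0.
have [rE|rN] := eqVneq r 0; first by apply: le_trans P0; exact: f0.
have rp : 0 < r by rewrite lt_neqAle eq_sym rN.
have rnp : 0 < (r ^+ n) ^+ n.-1 by rewrite !exprn_gt0.
rewrite -(ler_pM2l rnp) -E -exprM mulnC exprM.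
have -> : (r ^+ n.-1) ^+ n = \prod_(i < n) r ^+ n.-1 by rewrite prodr_const card_ord.
rewrite -big_split /=.
apply: ler_prod => i _; have /andP[a b] := sr i.
rewrite divr_ge0 ?(ltW h0) ?subr_ge0 ?lerXn2r ?nnegrE //= mulrA ler_pM2r ?invr_gt0 //.
by apply: le_trans (subrX_le n (sr i)) _; rewrite mulrCA mulrA.
Qed.

(** The reverse mean value bound [n s^(n-1) (r - s) <= r^n - s^n] loses a factor
    [(s / r)^(n-1)].  It is close to 1 only if one grid step changes [r] by a small
    fraction [t] of itself, which is why this direction needs [r] to stay away
    from 0, while [root_scheme_supersolution] does not. *)
Lemma root_scheme_subsolution (R : realFieldType) (n : nat) (h r t f : R) (s q : 'I_n -> R) :
  0 < h -> 0 < r -> 0 <= t <= 1 -> (forall i, 0 <= s i) ->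
  (forall i, 0 <= q i) -> (forall i, h * q i <= t * r) ->
  (forall i, s i <= r - h * q i) ->
  \prod_(i < n) ((r ^+ n - s i ^+ n) / h) = (r ^+ n) ^+ n.-1 * f ->
  (1 - t) ^+ (n.-1 * n) * \prod_(i < n) (n%:R * q i) <= f.
Proof.
move=> h0 rp /andP[t0 t1] s0 q0 qt sq E.
have rnp : 0 < (r ^+ n) ^+ n.-1 by rewrite !exprn_gt0.
rewrite -(ler_pM2l rnp) -E -[(r ^+ n) ^+ n.-1]exprM mulnC exprM [(1 - t) ^+ _]exprM mulrA -exprMn.
apply: prod_scale_le => [|i|i]; rewrite ?mulr_ge0 ?exprn_ge0 ?subr_ge0 ?(ltW rp) //.
have trr : t * r <= r by rewrite ler_piMl // ltW.
set y := r - h * q i.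
have y0 : (1 - t) * r <= y by rewrite /y mulrBl mul1r lerB.
have y00 : 0 <= y by apply: le_trans y0; rewrite mulr_ge0 ?subr_ge0 // ltW.
have yr : y <= r by rewrite gerBl mulr_ge0 // ltW.
rewrite ler_pdivlMr //.
apply: le_trans (_ : r ^+ n - y ^+ n <= _); last by rewrite lerB // lerXn2r ?nnegrE.
apply: le_trans (@subrX_ge _ r y n _); last by rewrite y00.
rewrite /y subKr -/y -exprMn [r * _]mulrC.
have -> : ((1 - t) * r) ^+ n.-1 * (n%:R * q i) * h =
  n%:R * ((1 - t) * r) ^+ n.-1 * (h * q i) by ring.
apply: ler_wpM2r; first by rewrite mulr_ge0 // ltW.
rewrite ler_wpM2l // lerXn2r // nnegrE // mulr_ge0 ?subr_ge0 //; exact: ltW.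
Qed.

(** At the largest neighbouring value [A] the product vanishes, and for large
    [t] it grows like [t ^+ n]; the intermediate value theorem for polynomials
    gives a root beyond [A]. *)
Lemma exists_scheme_root (R : rcfType) (n : nat) (h f : R) (a : 'I_n -> R) (A : R) :
  (1 <= n)%N -> 0 < h -> 0 <= f -> 0 <= A -> (forall i, 0 <= a i <= A) -> 
  (exists i, a i = A) -> 
  exists2 t, A <= t & \prod_(i < n) ((t - a i) / h) = t ^+ n.-1 * f.
Proof.
move=> n1 h0 f0 A0 aA [i0 ai0].
pose p : {poly R} := \prod_(i < n) (('X - (a i)%:P) * (h^-1)%:P) - 'X^(n.-1) * f%:P.
have pE t : p.[t] = \prod_(i < n) ((t - a i) / h) - t ^+ n.-1 * f.
  by rewrite /p !hornerE horner_prod; congr (_ - _); apply: eq_bigr => i _; rewrite !hornerE.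
(* Beyond [A *+ 2] each factor is at least [t / (2 * h)]; the second summand
   then makes the product exceed [t ^+ n.-1 * f]. *)
pose T := A *+ 2 + (2 * h) ^+ n * f.
have T0 : 0 <= (2 * h) ^+ n * f by rewrite mulr_ge0 // exprn_ge0 // mulr_ge0 // ltW.
have AT : A <= T by rewrite /T mulr2n; lra.
have ivt : p.[A] <= 0 <= p.[T].
  rewrite !pE; apply/andP; split.
    rewrite (bigD1 i0) //= ai0 subrr !mul0r sub0r oppr_le0 mulr_ge0 // exprn_ge0 //.
  rewrite subr_ge0; apply: le_trans (_ : \prod_(i < n) (T / (2 * h)) <= _); last first.
    apply: ler_prod => i _; rewrite divr_ge0 ?(le_trans A0 AT) ?mulr_ge0 ?(ltW h0) //=.
    rewrite invfM mulrA ler_pM2r ?invr_gt0 // /T mulr2n; have /andP[] := aA i.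
    by move=> ? ?; lra.
  have hp : 0 < (2 * h) ^+ n by rewrite exprn_gt0 // mulr_gt0.
  rewrite prodr_const card_ord expr_div_n ler_pdivlMr // -[in leRHS](prednK n1) exprSr.
  rewrite -mulrA ler_wpM2l //; first by rewrite exprn_ge0 // (le_trans A0).
  by rewrite /T mulrC lerDr mulr2n addr_ge0.
have [t /andP[At tT] /rootP] := poly_ivt AT ivt.
by rewrite pE => /subr0_eq ?; exists t.
Qed.

(** * The grid and the faces of the cube *)

Section Grid.
Context {R : realType} {n : nat}.
Implicit Types (x y : 'rV[R]_n) (h : R).

Definition grid h : set 'rV[R]_n := unit_cube `&` lattice h.

Lemma half_open_unit_cube x : half_open_cube x -> unit_cube x.
Proof. by move=> H i; have /andP[/ltW -> ->] := H i. Qed.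

Lemma shift_coord h x (i j : 'I_n) :
  (x - h *: basis_vec i) 0 j = x 0 j - h * (j == i)%:R.
Proof. by rewrite !mxE eqxx. Qed.

(** Moving slightly in the direction [- e_i] leaves the cube, so such a point is
    not interior. *)
Lemma Gamma_zero_coord x (i : 'I_n) : unit_cube x -> x 0 i = 0 -> Gamma x.
Proof.
move=> cx xi0; split; last by move=> /(_ i); rewrite xi0 ltxx.
split; first exact: subset_closure.
move=> /nbhs_ballP[e /= e0 be].
have /(_ i) : unit_cube (x - (e / 2) *: basis_vec i).
  apply: be; split=> // j k; rewrite ord1 /ball /= shift_coord opprB addrC subrK.
  rewrite normrM (gtr0_norm (_ : 0 < e / 2)) ?divr_gt0 //.
  apply: le_lt_trans (_ : e / 2 < e); last by rewrite gtr_pMr // invf_lt1 // ltr1n.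
  by rewrite ler_piMr ?divr_ge0 ?(ltW e0) //; case: eqP => _; rewrite ?normr1 ?normr0.
rewrite shift_coord xi0 eqxx mulr1 sub0r oppr_ge0 => /andP[+ _].
by rewrite leNgt divr_gt0.
Qed.

Lemma cube_cases x : unit_cube x ->
  half_open_cube x \/ exists i, x 0 i = 0 /\ Gamma x.
Proof.
move=> cx; have [[i xi]|H] := pselect (exists i, x 0 i = 0).
  by right; exists i; split => //; exact: Gamma_zero_coord xi.
left => i; have /andP[a ->] := cx i; rewrite andbT lt_neqAle a andbT eq_sym.
by apply/eqP => xi; apply: H; exists i.
Qed.

Lemma grid_shift h x (i : 'I_n) : 0 < h ->
  (half_open_cube `&` lattice h) x -> grid h (x - h *: basis_vec i).
Proof.
move=> h0 [cx lx]; split=> j; rewrite shift_coord; last first.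
  have [k ->] := lx j; exists (k - (j == i)%:Z).
  by rewrite intrB mulrBr; case: (j == i).
have /andP[xj0 xj1] := cx j; case: eqP => [_|_]; last by rewrite mulr0 subr0 (ltW xj0).
have [k xjE] := lx j; rewrite mulr1.
have kp : (0 < k)%R by move: xj0; rewrite xjE pmulr_rgt0 // ltr0z.
rewrite subr_ge0 (_ : h <= x 0 j) /=; last first.
  by rewrite xjE ler_peMr ?(ltW h0) // ler1z.
by rewrite (le_trans _ xj1) // gerBl ltW.
Qed.

(** Each backward step lowers the sum of the coordinates by [h], so
    the recursion that defines the scheme is well founded. *)
Lemma grid_ind h (P : 'rV[R]_n -> Prop) : 0 < h ->
  (forall x (i : 'I_n), grid h x -> x 0 i = 0 -> Gamma x -> P x) ->
  (forall x, (half_open_cube `&` lattice h) x ->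
     (forall i, P (x - h *: basis_vec i)) -> P x) ->
  forall x, grid h x -> P x.
Proof.
move=> h0 P0 PS x gx.
have claim k : forall y, grid h y -> \sum_i y 0 i < h * k%:R -> P y.
  elim: k => [y gy|k IH y gy yk].
    rewrite mulr0 ltNge sumr_ge0 // => i _.
    by have [/(_ i)/andP[]] := gy.
  have [yo|[i [yi Gy]]] := cube_cases gy.1; last exact: (P0 y i).
  have yl : (half_open_cube `&` lattice h) y by split=> //; exact: gy.2.
  apply: PS => // i; apply: IH; first exact: grid_shift.
  under eq_bigr do rewrite shift_coord.
  have -> : \sum_j (y 0 j - h * (j == i)%:R) = \sum_j y 0 j - h.
    rewrite sumrB -mulr_sumr; congr (_ - _).
    by rewrite (bigD1 i) //= eqxx big1 ?addr0 ?mulr1 // => j /negPf ->.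
  by rewrite ltrBlDr -[X in _ + X](mulr1 h) -mulrDr natr1.
apply: (claim (Num.truncn (\sum_i x 0 i / h)).+1) => //.
rewrite mulrC -ltr_pdivrMr // mulr_suml.
exact: truncnS_gt.
Qed.

End Grid.

(** * The maximal solution of the scheme *)

Section Scheme.
Context {R : realType} {n : nat}.
Variables (f g : 'rV[R]_n -> R) (h : R).
Hypotheses (n1 : (1 <= n)%N) (h0 : 0 < h).
Hypothesis f0 : forall x, unit_cube x -> 0 <= f x.
Hypothesis Sg : S2_maximal_solution f h g.
Implicit Types x : 'rV[R]_n.

Lemma S2_equation_update x t :
  (forall i, g (x - h *: basis_vec i) <= t) ->
  \prod_(i < n) ((t - g (x - h *: basis_vec i)) / h) = t ^+ n.-1 * f x ->
  S2_equation f h [eta g with x |-> t] x.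
Proof.
move=> gt E; rewrite /S2_equation /= eqxx -E; apply: eq_bigr => i _.
rewrite /backward_diff /= eqxx ifF; last first.
  apply/negbTE/eqP => /rowP/(_ i); rewrite shift_coord eqxx mulr1 => /eqP.
  by rewrite -subr_eq0 addrC addKr oppr_eq0 (gt_eqF h0).
by rewrite /pospart max_l // divr_ge0 ?(ltW h0) // subr_ge0.
Qed.

(** [exists_scheme_root] gives a root above all the neighbouring values, and the
    maximal solution is at least this root.  Nonnegativity and monotonicity are
    proved together because the existence of the root relies on the neighbouring
    values being nonnegative. *)
Lemma S2_sol_monotone x : grid h x -> 0 <= g x /\
  (half_open_cube x -> forall i, g (x - h *: basis_vec i) <= g x).
Proof.
move: x; apply: (grid_ind h0) => [x i gx xi Gx|x xl IH].
  rewrite Sg.1; last by split=> //; exact: gx.2.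
  by split=> // /(_ i); rewrite xi ltxx.
pose a i := g (x - h *: basis_vec i).
have a0 i : 0 <= a i by have [] := IH i.
pose i0 := [arg max_(i > Ordinal n1) a i]%O.
have ai i : a i <= a i0 by rewrite /i0; case: arg_maxP => // j _; apply.
have aa i : 0 <= a i <= a i0 by rewrite a0 ai.
have fx : 0 <= f x by apply: f0; apply: half_open_unit_cube; exact: xl.1.
have [t At tE] := exists_scheme_root n1 h0 fx (a0 i0) aa (ex_intro _ i0 erefl).
have tg : t <= g x.
  apply: (Sg.2 x xl).2; apply: S2_equation_update => // i.
  exact: le_trans (ai i) At.
split; first by rewrite (le_trans (a0 i0)) // (le_trans At).
by move=> _ i; rewrite (le_trans (ai i)) // (le_trans At).
Qed.

Lemma S2_sol_ge0 x : grid h x -> 0 <= g x.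
Proof. by move=> /S2_sol_monotone[]. Qed.

Lemma S2_sol_shift x i : (half_open_cube `&` lattice h) x ->
  0 <= g (x - h *: basis_vec i) <= g x.
Proof.
move=> xl; rewrite S2_sol_ge0; last exact: grid_shift.
apply: (@S2_sol_monotone x _).2; last exact: xl.1.
by split; [apply: half_open_unit_cube; exact: xl.1|exact: xl.2].
Qed.

Lemma S2_sol_eq x : (half_open_cube `&` lattice h) x ->
  \prod_(i < n) ((g x - g (x - h *: basis_vec i)) / h) = g x ^+ n.-1 * f x.
Proof.
move=> xl; rewrite -(Sg.2 x xl).1; apply: eq_bigr => i _.
rewrite /pospart max_l // /backward_diff divr_ge0 ?(ltW h0) // subr_ge0.
by have /andP[] := @S2_sol_shift x i xl.
Qed.

(** If the largest root is 0 then all neighbouring values are 0, and in that case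
    [h ^+ n * f x] is a root as well. *)
Lemma S2_sol_eq0 x : (half_open_cube `&` lattice h) x -> g x = 0 -> f x <= 0.
Proof.
move=> xl gx0.
have a0 i : g (x - h *: basis_vec i) = 0.
  by apply/le_anti; have := @S2_sol_shift x i xl; rewrite gx0 andbC.
have fx : 0 <= f x by apply: f0; apply: half_open_unit_cube; exact: xl.1.
have hn : 0 < h ^+ n by rewrite exprn_gt0.
suff : h ^+ n * f x <= g x by rewrite gx0 pmulr_rle0.
apply: (Sg.2 x xl).2; apply: S2_equation_update => [i|].
  by rewrite a0 mulr_ge0 // ltW.
under eq_bigr do rewrite a0 subr0.
rewrite prodr_const card_ord expr_div_n.
have -> : (h ^+ n * f x) ^+ n = (h ^+ n * f x) ^+ n.-1 * (h ^+ n * f x).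
  by rewrite -exprSr prednK.
by rewrite -mulrA mulrAC divff ?mul1r // (gt_eqF hn).
Qed.

(** The function [M * \prod_i x_i] is an exact solution of the scheme for
    constant [f = M]; this is the comparison with it.  The bound shows that the
    maximal solution is small near [Gamma], uniformly in [h]. *)
Lemma S2_sol_le_prod (M : R) : (forall x, unit_cube x -> f x <= M) ->
  forall x, grid h x -> g x <= M * \prod_(i < n) x 0 i.
Proof.
move=> fM; apply: (grid_ind h0) => [x i gx xi Gx|x xl IH].
  rewrite Sg.1; last by split=> //; exact: gx.2.
  by rewrite (bigD1 i) //= xi mul0r mulr0.
set T := M * _; rewrite leNgt; apply/negP => Tg.
have xp i : 0 < x 0 i by have /andP[] := xl.1 i.
have cx : unit_cube x by apply: half_open_unit_cube; exact: xl.1.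
have M0 : 0 <= M by apply: le_trans (fM _ cx); exact: f0.
have Pp : 0 < \prod_(i < n) x 0 i by exact: prodr_gt0.
have T0 : 0 <= T by rewrite mulr_ge0 // ltW.
have gp : 0 < g x by exact: le_lt_trans Tg.
have bi i : g (x - h *: basis_vec i) <= T * (1 - h / x 0 i).
  apply: le_trans (IH i) _; rewrite /T -mulrA ler_wpM2l //.
  rewrite (bigD1 i) //= [in leRHS](bigD1 i) //= shift_coord eqxx mulr1.
  rewrite le_eqVlt; apply/orP; left; apply/eqP.
  under eq_bigr => j /negPf ji do rewrite shift_coord ji mulr0 subr0.
  by field; rewrite (gt_eqF (xp i)).
have hx i : h / x 0 i <= 1.
  rewrite ler_pdivrMr // mul1r.
  have [/(_ i) + _] := @grid_shift _ _ _ _ i h0 xl.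
  by rewrite shift_coord eqxx mulr1 subr_ge0 => /andP[].
have di i : 1 * (g x / x 0 i) <= (g x - g (x - h *: basis_vec i)) / h.
  rewrite mul1r ler_pdivlMr // lerBrDr addrC -lerBrDr.
  apply: le_trans (bi i) _.
  have -> : g x - g x / x 0 i * h = g x * (1 - h / x 0 i) by ring.
  by rewrite ler_wpM2r ?subr_ge0 // ltW.
have := @prod_scale_le _ _ _ (fun i => g x / x 0 i) _ ler01 _ di.
have gxi i : 0 <= g x / x 0 i by rewrite divr_ge0 ?(ltW gp) // ltW.
move=> /(_ gxi); rewrite S2_sol_eq // expr1n mul1r big_split /= prodr_const card_ord.
rewrite -[in X in X * _ <= _](prednK n1) exprSr prodfV -mulrA.
rewrite ler_pM2l ?exprn_gt0 // ler_pdivrMr // => gM.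
move: Tg; rewrite ltNge (le_trans gM) // /T ler_wpM2r ?(ltW Pp) //; exact: fM.
Qed.

End Scheme.

(** * Compactness of the cube and quadratic test functions *)

Section Cube.
Context {R : realType} {n : nat}.
Implicit Types (x y : 'rV[R]_n).

Lemma compact_unit_cube : compact (@unit_cube R n).
Proof.
have := @rV_compact R n (fun _ => `[0, 1]%classic) (fun _ => @segment_compact R 0 1).
congr compact; apply/seteqP; split => x /= H i; have := H i; by rewrite /= in_itv.
Qed.

(** Heine's theorem, stated coordinatewise. *)
Lemma cube_unif_continuous (f : 'rV[R]_n -> R) (e : R) :
  {within unit_cube, continuous f} -> 0 < e ->
  exists2 d, 0 < d & forall x y, unit_cube x -> unit_cube y ->
    (forall i, `|x 0 i - y 0 i| < d) -> `|f x - f y| < e.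
Proof.
move=> /subspace_continuousP cf e0.
pose P (d : R) x := unit_cube x ->
  forall y, unit_cube y -> ball x d y -> `|f x - f y| < e.
have : \forall d \near (0 : R)^'+, unit_cube `<=` P d.
  apply: (compact_near_coveringP _).1 compact_unit_cube _ _ _ _ _ => x cx.
  have /(_ (ball (f x) (e / 2))) := cf x cx.
  move=> /(_ (nbhsx_ballx _ _ _)); rewrite divr_gt0 // => /(_ isT).
  move=> /nbhs_ballP[r /= r0 Hr].
  exists (ball x (r / 2), [set d | d < r / 2]) => /=.
    split; first by apply: nbhsx_ballx; rewrite divr_gt0.
    by apply: nbhs_right_lt; rewrite divr_gt0.
  move=> [x' d] /= [bx' dr] cx' y cy bd.
  have bxx' : ball x r x'.
    by apply: le_ball bx'; rewrite ler_pdivrMr // ler_peMr ?(ltW r0) // ler1n.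
  have bxy : ball x r y.
    by rewrite [r]splitr; apply: ball_triangle bx' _; apply: le_ball bd; exact: ltW.
  have := Hr _ bxx' cx'; have := Hr _ bxy cy; rewrite /ball /= => A B.
  rewrite [e]splitr -[f x'](subrK (f x)) -addrA.
  by rewrite (le_lt_trans (ler_normD _ _)) // ltrD // distrC.
move=> H.
have [d [d0 Hd]] : exists d : R, 0 < d /\ unit_cube `<=` P d.
  near (0 : R)^'+ => d; exists d; split=> //.
  by near: d.
exists d => // x y cx cy xy; apply: (Hd _ cx cx _ cy).
by split=> // i j; rewrite ord1 /ball /=.
Unshelve. all: by end_near.
Qed.

Lemma cube_bounded (f : 'rV[R]_n -> R) : {within unit_cube, continuous f} ->
  exists M, forall x, unit_cube x -> f x <= M.
Proof.
move=> cf; have c0 : @unit_cube R n 0 by move=> i; rewrite mxE lexx ler01.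
have [c _ fc] := compact_EVT_max (ex_intro _ 0 c0) compact_unit_cube cf.
by exists (f c) => x cx; apply: fc; rewrite inE.
Qed.

(** The first argument ranges over finitely many points, so continuity is only
    needed in the second one. *)
Lemma grid_cube_max (h : R) (F : 'rV[R]_n -> 'rV[R]_n -> R) : 0 < h ->
  (forall x, grid h x -> {within unit_cube, continuous (F x)}) ->
  exists x y, [/\ grid h x, unit_cube y &
    forall x' y', grid h x' -> unit_cube y' -> F x' y' <= F x y].
Proof.
move=> h0 cF; have c0 : @unit_cube R n 0 by move=> i; rewrite mxE lexx ler01.
pose N := Num.truncn h^-1.
have hN : h * N%:R <= 1.
  by rewrite mulrC -ler_pdivlMr // mul1r truncn_le // invr_ge0 ltW.
pose pt (k : {ffun 'I_n -> 'I_N.+1}) : 'rV[R]_n := \row_i (h * (k i)%:R).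
have gpt k : grid h (pt k).
  split=> i; rewrite mxE; last by exists (k i)%:Z; rewrite pmulrn.
  rewrite mulr_ge0 ?(ltW h0) //= (le_trans _ hN) // ler_pM2l // ler_nat -ltnS //.
have ptP x : grid h x -> exists k, x = pt k.
  move=> [cx lx].
  have /choice[k kP] : forall i, exists k : 'I_N.+1, x 0 i = h * k%:R.
    move=> i; have [z xz] := lx i; have /andP[x0 x1] := cx i.
    have z0 : (0 <= z)%R by move: x0; rewrite xz pmulr_rge0 // ler0z.
    case: z z0 xz => // m _ xz.
    have mN : (m < N.+1)%N.
      by rewrite ltnS truncn_ge_nat ?invr_ge0 ?(ltW h0) // -div1r ler_pdivlMr // mulrC pmulrn -xz.
    by exists (Ordinal mN); rewrite xz -pmulrn.
  by exists [ffun i => k i]; apply/rowP => i; rewrite mxE ffunE kP.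
have /choice[m mP] : forall k, exists y, unit_cube y /\
    forall y', unit_cube y' -> F (pt k) y' <= F (pt k) y.
  move=> k; have [c] := compact_EVT_max (ex_intro _ 0 c0) compact_unit_cube (cF _ (gpt k)).
  rewrite inE => cc H; exists c; split=> // y' cy'; apply: H; by rewrite inE.
pose k0 := [arg max_(k > [ffun=> ord0]) F (pt k) (m k)]%O.
exists (pt k0), (m k0); split => //; first by have [] := mP k0.
move=> x' y' /ptP[k ->] cy'; apply: le_trans ((mP k).2 _ cy') _.
by rewrite /k0; case: arg_maxP => // j _; apply.
Qed.

(** All test functions have this form: a linear term that provides strictness
    and the quadratic penalty of the doubling of variables. *)
Definition quad (b k : R) (c y : 'rV[R]_n) : R :=
  \sum_(j < n) (b * y 0 j + k * (y 0 j - c 0 j) ^+ 2).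

Lemma is_derive_coord (x v : 'rV[R]_n) j :
  is_derive x v (fun y : 'rV[R]_n => y 0 j : R) (v 0 j).
Proof.
apply: DeriveDef; first exact/diff_derivable/differentiable_coord.
apply: cvg_lim => //; apply: cvg_near_cst.
near=> t; rewrite /= !mxE addrK /GRing.scale /= mulKf //.
near: t; exact: nbhs_dnbhs_neq.
Unshelve. all: by end_near.
Qed.

Lemma is_derive_quad b k c x (i : 'I_n) :
  is_derive x (basis_vec i) (quad b k c) (b + 2 * k * (x 0 i - c 0 i)).
Proof.
have -> : quad b k c =
  \sum_(j < n) ((cst b * (fun y => y 0 j)) + cst k * ((fun y => y 0 j) - cst (c 0 j)) ^+ 2).
  by apply/funext => y; rewrite /quad fct_sumE.
have dj j := is_derive_coord x (basis_vec i) j.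
apply: is_derive_eq => /=.
rewrite (bigD1 i) //= big1 ?addr0 => [|j /negPf ji].
  rewrite !mxE !eqxx /GRing.scale /= expr1.
  rewrite [((fun y => y 0 i) - cst (c 0 i)) x](_ : _ = x 0 i - c 0 i) //; ring.
by rewrite !mxE ji andbF /GRing.scale /=; ring.
Qed.

Lemma C1_quad b k c : C1 (quad b k c).
Proof.
split.
  move=> x.
  have -> : quad b k c =
    \sum_(j < n) ((cst b * (fun y => y 0 j)) + cst k * ((fun y => y 0 j) - cst (c 0 j)) ^+ 2).
    by apply/funext => y; rewrite /quad fct_sumE.
  apply: differentiable_sum => j; have dj := @differentiable_coord R 1 n x 0 j.
  have dB : differentiable ((fun y : 'rV[R]_n => y 0 j) - cst (c 0 j)) x.
    exact: (differentiableB dj (differentiable_cst _ _)).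
  apply: differentiableD; first exact: (@differentiableM _ _ (cst b) _ x (differentiable_cst _ _) dj).
  apply: (@differentiableM _ _ (cst k) _ x (differentiable_cst _ _)).
  exact: (@differentiableX _ _ _ 1 x dB).
move=> i.
have -> : (fun x => 'D_(basis_vec i) (quad b k c) x) = (fun x => b + 2 * k * (x 0 i - c 0 i)).
  apply/funext => x; have H := is_derive_quad b k c x i; exact: derive_val.
move=> x.
have cB : {for x, continuous ((fun y : 'rV[R]_n => y 0 i) - cst (c 0 i))}.
  by apply: continuousB; [exact: coord_continuous|exact: cst_continuous].
have cM : {for x, continuous (cst (2 * k) * ((fun y : 'rV[R]_n => y 0 i) - cst (c 0 i)))}.
  by apply: continuousM cB; exact: cst_continuous.
by apply: (@continuousD _ _ _ (cst b) _ _ _ cM); exact: cst_continuous.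
Qed.

End Cube.

Section QuadraticPenalty.
Context {R : realType} {n : nat}.
Implicit Types (x y c : 'rV[R]_n).

Lemma quad_shift b k c y (i : 'I_n) s :
  quad b k c (y - s *: basis_vec i) =
  quad b k c y - s * (b + k * (2 * (y 0 i - c 0 i) - s)).
Proof.
rewrite /quad (bigD1 i) //= [in RHS](bigD1 i) //= shift_coord eqxx mulr1.
under eq_bigr => j /negPf ji do rewrite shift_coord ji mulr0 subr0.
ring.
Qed.

Lemma quad_shift_center b k c y (i : 'I_n) s :
  quad b k (c - s *: basis_vec i) y =
  quad b k c y + s * k * (2 * (y 0 i - c 0 i) + s).
Proof.
rewrite /quad (bigD1 i) //= [in RHS](bigD1 i) //= shift_coord eqxx mulr1.
under eq_bigr => j /negPf ji do rewrite shift_coord ji mulr0 subr0.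
ring.
Qed.

Lemma quad_ge_coord b k c y (i : 'I_n) : 0 <= b -> 0 <= k -> unit_cube y ->
  k * (y 0 i - c 0 i) ^+ 2 <= quad b k c y.
Proof.
move=> b0 k0 cy; rewrite /quad (bigD1 i) //= -addrA [leRHS]addrCA lerDl addr_ge0 //.
  by rewrite mulr_ge0 //; case/andP: (cy i).
apply: sumr_ge0 => j _; rewrite addr_ge0 // mulr_ge0 ?sqr_ge0 //.
by case/andP: (cy j).
Qed.

Lemma quad_diag b k c : 0 <= b -> unit_cube c -> quad b k c c <= n%:R * b.
Proof.
move=> b0 cc; apply: le_trans (_ : \sum_(j < n) b <= _); last first.
  by rewrite sumr_const card_ord mulr_natl.
apply: ler_sum => j _; rewrite subrr expr0n /= mulr0 addr0 ler_piMr //.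
by case/andP: (cc j).
Qed.

Lemma quadN b k c y : quad (- b) (- k) c y = - quad b k c y.
Proof. by rewrite /quad -sumrN; apply: eq_bigr => j _; ring. Qed.

Lemma quad_within b k c : {within unit_cube, continuous (quad b k c)}.
Proof.
apply: continuous_subspaceT => x; apply: differentiable_continuous.
by have [] := @C1_quad R n b k c.
Qed.

Lemma cube_shift x (i : 'I_n) s : unit_cube x -> 0 <= s <= x 0 i ->
  unit_cube (x - s *: basis_vec i).
Proof.
move=> cx /andP[s0 sx] j; rewrite shift_coord; have /andP[x0 x1] := cx j.
case: eqP => [->|_]; last by rewrite mulr0 subr0 x0.
have /andP[y0 y1] := cx i.
by rewrite mulr1 subr_ge0 sx lerBlDr (le_trans y1) // lerDl.
Qed.

Lemma nondecreasing_ge0 (u : 'rV[R]_n -> R) : (1 <= n)%N ->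
  (forall x, Gamma x -> u x = 0) -> nondecreasing_on_cube u ->
  forall x, unit_cube x -> 0 <= u x.
Proof.
move=> n1 uG um x cx; pose i := Ordinal n1.
have /andP[x0 x1] := cx i.
have cx' : unit_cube (x - x 0 i *: basis_vec i) by apply: cube_shift; rewrite ?x0 ?lexx.
have xi0 : (x - x 0 i *: basis_vec i) 0 i = 0 by rewrite shift_coord eqxx mulr1 subrr.
rewrite -(uG _ (Gamma_zero_coord cx' xi0)); apply: (um _ _ i cx' cx _ _); last by rewrite xi0.
by move=> j /negPf ji; rewrite shift_coord ji mulr0 subr0.
Qed.

End QuadraticPenalty.

Section Root.
Context {R : realType} (n : nat).
Hypothesis n1 : (1 <= n)%N.

Definition rootn (a : R) : R := a `^ (n%:R^-1).

Lemma rootn_ge0 a : 0 <= rootn a. Proof. exact: powR_ge0. Qed.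
Lemma rootnK a : 0 <= a -> rootn a ^+ n = a.
Proof.
move=> a0; rewrite -powR_mulrn ?rootn_ge0 // /rootn -powRrM mulVf ?powRr1 //.
by rewrite pnatr_eq0 -lt0n.
Qed.
Lemma le_rootn a b : 0 <= a <= b -> rootn a <= rootn b.
Proof.
move=> /andP[a0 ab]; apply: ge0_ler_powR; rewrite ?nnegrE ?invr_ge0 ?ler0n //.
exact: le_trans ab.
Qed.
End Root.

(** Losing a factor [1 - t] a bounded number of times costs less than half of
    the strictness [E] when [t] is small. *)
Lemma strictness_gap (R : realFieldType) (n k : nat) (t a b E M : R) :
  (k <= n * n)%N -> 0 <= t <= 1 -> 0 <= a <= M -> 0 < E ->
  (n * n)%:R * t * (M + E) <= E / 2 -> (1 - t) ^+ k * (a + E) <= b ->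
  a + E / 2 <= b.
Proof.
move=> kn t01 /andP[a0 aM] E0 H; apply: le_trans.
have [t0 t1] := andP t01.
have aE : 0 <= a + E by rewrite addr_ge0 // ltW.
apply: le_trans (_ : (1 - k%:R * t) * (a + E) <= _); last first.
  by rewrite ler_wpM2r // bernoulli_ge.
have : k%:R * t * (a + E) <= (n * n)%:R * t * (M + E).
  by rewrite ler_pM ?mulr_ge0 ?lerD2r // ler_wpM2r // ler_nat.
by move=> ?; lra.
Qed.

(** * Comparison of the scheme with the viscosity solution *)

Section Comparison.
Context {R : realType} {n : nat}.
Variables (f u g : 'rV[R]_n -> R).
Hypotheses (n1 : (1 <= n)%N).
Hypothesis f0 : forall x, unit_cube x -> 0 <= f x.
Hypothesis uS : P1_viscosity_solution f u.
Hypothesis um : nondecreasing_on_cube u.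
Variables (s e d k t M W h : R).
Hypotheses (s0 : 0 < s) (e0 : 0 < e) (d0 : 0 < d) (k0 : 0 < k) (h0 : 0 < h).
Hypothesis t01 : 0 <= t <= 1.
Hypothesis Sg : S2_maximal_solution f h g.
Hypothesis fM : forall x, unit_cube x -> f x <= M.
Hypothesis uW : forall x, unit_cube x -> u x <= W.
Hypothesis gW : forall x, grid h x -> n%:R * rootn n (g x) <= W.
Hypothesis f_mod : forall x y, unit_cube x -> unit_cube y ->
  (forall i, `|x 0 i - y 0 i| < d) -> `|f x - f y| < e ^+ n / 2.
Hypothesis u_mod : forall x y, unit_cube x -> unit_cube y ->
  (forall i, `|x 0 i - y 0 i| < d) -> `|u x - u y| < s.
(* [Md] and [Wk] say that [d] is so small that the scheme is below level [s]
   near [Gamma], and [k] so large that the penalty forces the two points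
   within distance [d].  The number [t] bounds every relative error of order
   [h], by [hs] and [he], and [tE] makes it harmless compared to the strictness
   [e ^+ n]. *)
Hypothesis Md : M * d < (s / n%:R) ^+ n.
Hypothesis Wk : W < k * d ^+ 2.
Hypothesis tE : (n * n)%:R * t * (M + e ^+ n) <= e ^+ n / 2.
Hypothesis hs : 2 * k * h <= t * s.
Hypothesis he : k * h <= t * e.

Let w x := n%:R * rootn n (g x).
Let np : 0 < n%:R :> R. Proof. by rewrite ltr0n. Qed.
Let u0 x : unit_cube x -> 0 <= u x.
Proof. by apply: nondecreasing_ge0 => //; case: uS. Qed.
Let E0 : 0 < e ^+ n. Proof. by rewrite exprn_gt0. Qed.
Let w_zero x : grid h x -> Gamma x -> w x = 0.
Proof.
move=> gx Gx; rewrite /w /rootn Sg.1; last by split=> //; case: gx.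
by rewrite powR0 ?mulr0 // invr_neq0 // gt_eqF.
Qed.
Let w0 x : 0 <= w x. Proof. by rewrite mulr_ge0 ?rootn_ge0. Qed.
Let penalty_near_diagonal b (x y : 'rV[R]_n) : 0 <= b -> unit_cube y -> quad b k x y <= W ->
  forall i, `|y 0 i - x 0 i| < d.
Proof.
move=> b0 cy qW i; rewrite -ltr_sqr ?nnegrE ?(ltW d0) // real_normK ?num_real //.
rewrite -(ltr_pM2l k0); apply: le_lt_trans Wk; apply: le_trans qW.
exact: quad_ge_coord (ltW k0) cy.
Qed.

Let scheme_eq x : (half_open_cube `&` lattice h) x ->
  \prod_(i < n) ((rootn n (g x) ^+ n - rootn n (g (x - h *: basis_vec i)) ^+ n) / h)
  = (rootn n (g x) ^+ n) ^+ n.-1 * f x.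
Proof.
move=> xl; have gx : 0 <= g x.
  have /andP[] := S2_sol_shift n1 h0 f0 Sg (Ordinal n1) xl; exact: le_trans.
rewrite rootnK // -(S2_sol_eq n1 h0 f0 Sg xl); apply: eq_bigr => i _.
by rewrite rootnK //; have /andP[] := S2_sol_shift n1 h0 f0 Sg i xl.
Qed.

(** Doubling of variables, the grid point [x] carrying the scheme and the
    point [y] carrying [u].  The term [- e * \sum_j y_j] makes [u] a strict
    supersolution.  At the maximum [w x > s], so the lower estimate for the scheme in
    [root_scheme_subsolution] is available. *)
Lemma scheme_le_viscosity x0 : grid h x0 -> w x0 - u x0 <= s + n%:R * e.
Proof.
move=> gx0; rewrite leNgt; apply/negP => ws.
pose F x y := w x - u y + quad (- e) (- k) x y.
have [uc uG uV] := uS.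
have [x [y [gx cy Fmax]]] : exists x y, [/\ grid h x, unit_cube y &
    forall x' y', grid h x' -> unit_cube y' -> F x' y' <= F x y].
  apply: grid_cube_max => // x _.
  have -> : F x = (cst (w x) - u) + quad (- e) (- k) x by [].
  move=> z; apply: continuousD; last exact: quad_within.
  by apply: continuousB; [exact: cst_continuous|exact: uc].
have cx := gx.1.
have Fs : s < F x y.
  apply: lt_le_trans (Fmax x0 x0 gx0 gx0.1); rewrite /F quadN ltrBrDr.
  apply: le_lt_trans ws; rewrite lerD2l quad_diag ?(ltW e0) //; exact: gx0.1.
have q0 : 0 <= quad e k x y.
  apply: le_trans (_ : _ <= k * (y 0 (Ordinal n1) - x 0 (Ordinal n1)) ^+ 2) _.
    by rewrite mulr_ge0 ?sqr_ge0 // ltW.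
  by apply: quad_ge_coord => //; exact: ltW.
have := u0 cy; rewrite /F quadN in Fs => uy0.
have sw : s < w x by lra.
have xy : forall i, `|y 0 i - x 0 i| < d.
  have wW : w x <= W := gW gx.
  by apply: (penalty_near_diagonal (ltW e0) cy); move: wW Fs uy0 s0; rewrite /w; lra.
have hx : half_open_cube x.
  have [//|[i [_ Gx]]] := cube_cases cx.
  by move: sw; rewrite w_zero // => /(lt_trans s0); rewrite ltxx.
have xl : (half_open_cube `&` lattice h) x by split=> //; exact: gx.2.
have gx_ge0 : 0 <= g x by exact: (S2_sol_ge0 n1 h0 f0 Sg).
have rs : s / n%:R < rootn n (g x) by rewrite ltr_pdivrMr // mulrC.
have hy : half_open_cube y.
  have [//|[i [yi _]]] := cube_cases cy.
  have : g x < (s / n%:R) ^+ n.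
    apply: le_lt_trans Md; apply: le_trans (S2_sol_le_prod n1 h0 f0 Sg fM gx) _.
    rewrite ler_wpM2l ?(le_trans (f0 cy)) ?fM // (bigD1 i) //=.
    have := xy i; rewrite yi sub0r normrN => /ltW xid.
    rewrite -[d]mulr1 ler_pM // ?prodr_ge0 ?(le_trans (ler_norm _) xid) //.
    - by case/andP: (cx i).
    - by move=> j _; case/andP: (cx j).
    - by apply: prodr_ile1 => j _; exact: cx.
  rewrite -[g x](rootnK n1) // ltr_pXn2r ?nnegrE ?rootn_ge0 ?divr_ge0 ?(ltW s0) //.
  by move=> /(lt_trans rs); rewrite ltxx.
pose p i := 2 * k * (x 0 i - y 0 i).
(* As [u] is nondecreasing, the maximum compared with the points
   [y - z *: e_i] bounds the slope from below.  Without this the positive parts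
   would hide the added [e] where [f] vanishes. *)
have pe i : e <= p i.
  rewrite leNgt; apply/negP => pe.
  have yi : 0 < y 0 i by case/andP: (hy i).
  pose z := Num.min (y 0 i) ((e - p i) / (2 * k)).
  have z0 : 0 < z by rewrite lt_min yi divr_gt0 ?subr_gt0 // mulr_gt0.
  have zy : z <= y 0 i by rewrite ge_min lexx.
  have zk : k * z <= (e - p i) / 2.
    apply: le_trans (_ : k * ((e - p i) / (2 * k)) <= _).
      by rewrite ler_pM2l // ge_min lexx orbT.
    by rewrite le_eqVlt; apply/orP; left; apply/eqP; field; rewrite gt_eqF.
  have cy' : unit_cube (y - z *: basis_vec i) by apply: cube_shift; rewrite ?(ltW z0).
  have uy : u (y - z *: basis_vec i) <= u y.
    apply: (@um _ _ i cy' cy); last by rewrite shift_coord eqxx mulr1 gerBl ltW.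
    by move=> j /negPf ji; rewrite shift_coord ji mulr0 subr0.
  have := Fmax x _ gx cy'; rewrite /F quad_shift.
  have : z * (e - p i - k * z) <= 0 -> False.
    by rewrite pmulr_rle0 // => ?; lra.
  by rewrite /p => A B; apply: A; lra.
have fy : f y + e ^+ n <= \prod_(i < n) p i.
  have [_] := uV y (quad (- e) (- k) x) hy (C1_quad _ _ _).
  have min : local_min_rel half_open_cube (fun z => u z - quad (- e) (- k) x z) y.
    rewrite /local_min_rel near_withinE.
    apply: filterE => z /half_open_unit_cube cz; have := Fmax x z gx cz; rewrite /F; lra.
  move=> /(_ min) fP.
  have -> : \prod_(i < n) p i = \prod_(i < n) ((p i - e) + e).
    by apply: eq_bigr => i _; rewrite subrK.
  apply: le_trans (prod_add_ge n1 (ltW e0) _); last by move=> i; rewrite subr_ge0.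
  rewrite lerD2r; apply: le_trans fP _; rewrite /P1_operator.
  rewrite le_eqVlt; apply/orP; left; apply/eqP; apply: eq_bigr => i _.
  have D := is_derive_quad (- e) (- k) x y i; rewrite derive_val.
  have -> : - e + 2 * - k * (y 0 i - x 0 i) = p i - e by rewrite /p; ring.
  by rewrite /pospart max_l // subr_ge0.
pose q i := (p i - k * h) / n%:R.
have nq i : n%:R * q i = p i - k * h by rewrite /q mulrC divfK // gt_eqF.
have [t0 t1] := andP t01.
have tp i : (1 - t) * p i <= n%:R * q i.
  rewrite nq mulrBl mul1r lerD2l lerN2; apply: le_trans he _.
  by rewrite ler_wpM2l.
have nq0 i : 0 <= n%:R * q i.
  by apply: le_trans (tp i); rewrite mulr_ge0 ?subr_ge0 // (le_trans (ltW e0)).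
have q_ge0 i : 0 <= q i by rewrite -(pmulr_rge0 _ np).
have := @root_scheme_subsolution R n h (rootn n (g x)) t (f x)
   (fun i => rootn n (g (x - h *: basis_vec i))) q h0 (lt_trans (divr_gt0 s0 np) rs) t01
   (fun i => rootn_ge0 _ _) q_ge0 _ _ (scheme_eq xl).
have qt i : h * q i <= t * rootn n (g x).
  apply: le_trans (_ : t * (s / n%:R) <= _); last by rewrite ler_wpM2l // ltW.
  rewrite -(ler_pM2l np) mulrCA nq.
  have -> : n%:R * (t * (s / n%:R)) = t * s by field; rewrite gt_eqF.
  apply: le_trans hs; rewrite mulrC ler_wpM2r ?(ltW h0) //.
  apply: le_trans (_ : p i <= _); first by rewrite gerBl mulr_ge0 // ltW.
  rewrite /p ler_piMr ?mulr_ge0 ?(ltW k0) //.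
  by have /andP[? ?] := cx i; have /andP[? ?] := cy i; lra.
have sq i : rootn n (g (x - h *: basis_vec i)) <= rootn n (g x) - h * q i.
  rewrite -(ler_pM2l np) mulrBr [n%:R * (h * q i)]mulrCA nq.
  have := Fmax _ y (grid_shift i h0 xl) cy; rewrite /F quad_shift_center /w /p; lra.
move=> /(_ qt sq) fx.
have : f y + e ^+ n / 2 <= f x.
  apply: (@strictness_gap _ n (n * n) t _ _ _ M) => //.
    by rewrite f0 // fM.
  apply: le_trans fx; have -> : (n * n = n.-1 * n + n)%N.
    by case: n n1 => // m _; rewrite mulSn addnC.
  rewrite exprD -mulrA ler_wpM2l ?exprn_ge0 ?subr_ge0 //.
  apply: le_trans (prod_scale_le _ _ tp); rewrite ?subr_ge0 //.
    by rewrite ler_wpM2l // exprn_ge0 // subr_ge0.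
  by move=> i; apply: le_trans (pe i); exact: ltW.
have := f_mod cy cx xy; rewrite distrC => /(le_lt_trans (ler_norm _)) A B; lra.
Qed.

(** The roles are exchanged: the point [x] carrying [u] varies in the cube, and
    [- e * \sum_j y_j] makes the scheme a strict supersolution at the grid
    point [y].  The root of the scheme is a supersolution without
    restriction, so a possible vanishing of the scheme at [y] is harmless. *)
Lemma viscosity_le_scheme x0 : grid h x0 -> u x0 - w x0 <= s + n%:R * e.
Proof.
move=> gx0; rewrite leNgt; apply/negP => ws.
pose F y x := u x - quad 0 k y x - (w y + quad e 0 0 y).
have [uc uG uV] := uS.
have [y [x [gy cx Fmax]]] : exists y x, [/\ grid h y, unit_cube x &
    forall y' x', grid h y' -> unit_cube x' -> F y' x' <= F y x].
  apply: grid_cube_max => // y _.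
  have -> : F y = (u - quad 0 k y) - cst (w y + quad e 0 0 y) by [].
  move=> z; apply: continuousB; last exact: cst_continuous.
  by apply: continuousB; [exact: uc|exact: quad_within].
have cy := gy.1.
have Fs : s < F y x.
  apply: lt_le_trans (Fmax x0 x0 gx0 gx0.1); rewrite /F.
  have := @quad_diag R n 0 k x0 (lexx 0) gx0.1.
  have := @quad_diag R n e 0 x0 (ltW e0) gx0.1.
  have -> : quad e 0 x0 x0 = quad e 0 0 x0.
    by apply: eq_bigr => j _; rewrite !mul0r.
  rewrite mulr0; lra.
have q0 : 0 <= quad 0 k y x.
  apply: le_trans (_ : _ <= k * (x 0 (Ordinal n1) - y 0 (Ordinal n1)) ^+ 2) _.
    by rewrite mulr_ge0 ?sqr_ge0 // ltW.
  by apply: quad_ge_coord => //; exact: ltW.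
have qe0 : 0 <= quad e 0 0 y.
  by apply: sumr_ge0 => j _; rewrite mul0r addr0 mulr_ge0 ?(ltW e0) //; case/andP: (cy j).
have wy0 := w0 y; rewrite /F in Fs.
have xy : forall i, `|x 0 i - y 0 i| < d.
  apply: (penalty_near_diagonal (lexx 0) cx); move: (uW cx) Fs qe0 wy0 s0; rewrite /w; lra.
have hx : half_open_cube x.
  have [//|[i [_ Gx]]] := cube_cases cx; move: (uG _ Gx) Fs qe0 q0 wy0 s0; rewrite /w; lra.
have hy : half_open_cube y.
  have [//|[i [_ Gy]]] := cube_cases cy.
  have := u_mod cx cy xy; rewrite (uG _ Gy) subr0 => /(le_lt_trans (ler_norm _)).
  by move: Fs qe0 q0 wy0 s0; rewrite /w; lra.
have yl : (half_open_cube `&` lattice h) y by split=> //; exact: gy.2.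
have gy_ge0 : 0 <= g y by exact: (S2_sol_ge0 n1 h0 f0 Sg).
pose p i := 2 * k * (x 0 i - y 0 i).
have fP : \prod_(i < n) pospart (p i) <= f x.
  have [+ _] := uV x (quad 0 k y) hx (C1_quad _ _ _).
  have max : local_max_rel half_open_cube (fun z => u z - quad 0 k y z) x.
    rewrite /local_max_rel near_withinE.
    apply: filterE => z /half_open_unit_cube cz; have := Fmax y z gy cz; rewrite /F; lra.
  move=> /(_ max); apply: le_trans; rewrite /P1_operator.
  rewrite le_eqVlt; apply/orP; left; apply/eqP; apply: eq_bigr => i _.
  have D := is_derive_quad 0 k y x i; rewrite derive_val.
  by rewrite add0r.
pose D i := n%:R * (rootn n (g y) - rootn n (g (y - h *: basis_vec i))) / h.
have rr i : 0 <= rootn n (g (y - h *: basis_vec i)) <= rootn n (g y).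
  by rewrite rootn_ge0 le_rootn //; exact: (S2_sol_shift n1 h0 f0 Sg i yl).
have D0 i : 0 <= D i.
  by rewrite divr_ge0 ?(ltW h0) // mulr_ge0 // subr_ge0; case/andP: (rr i).
have fD : f y <= \prod_(i < n) D i.
  apply: (root_scheme_supersolution n1 h0 rr _ (scheme_eq yl)) => r0.
  apply: (S2_sol_eq0 n1 h0 f0 Sg yl).
  by rewrite -[g y](rootnK n1) // r0 expr0n gtn_eqF.
have [t0 t1] := andP t01.
have Dp i : (1 - t) * (D i + e) <= pospart (p i).
  apply: le_trans (_ : p i <= _); last by rewrite /pospart le_max lexx.
  have : D i + e <= p i + k * h.
    rewrite -lerBrDr ler_pdivrMr //.
    have := Fmax _ x (grid_shift i h0 yl) cx.
    rewrite /F quad_shift_center quad_shift /w /p; lra.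
  have : t * e <= t * (D i + e) by rewrite ler_wpM2l // lerDr.
  by move: he; lra.
have : f y + e ^+ n / 2 <= f x.
  apply: (@strictness_gap _ n n t _ _ _ M) => //.
  - by rewrite leq_pmulr.
  - by rewrite f0 // fM.
  apply: le_trans fP; apply: le_trans (prod_scale_le _ _ Dp); rewrite ?subr_ge0 //.
    rewrite ler_wpM2l ?exprn_ge0 ?subr_ge0 //.
    by apply: le_trans (prod_add_ge n1 (ltW e0) D0); rewrite lerD2r.
  by move=> i; rewrite addr_ge0 // ltW.
have := f_mod cx cy xy => /(le_lt_trans (ler_norm _)) A B; lra.
Qed.

End Comparison.

(** * Convergence *)

Lemma normrX_sub_le (R : realFieldType) (n : nat) (a b W : R) :
  0 <= a <= W -> 0 <= b <= W ->
  `|a ^+ n - b ^+ n| <= n%:R * W ^+ n.-1 * `|a - b|.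
Proof.
wlog ba : a b / b <= a.
  move=> H ha hb; have [|/ltW] := leP b a => ?; first exact: H.
  by rewrite distrC [`|a - b|]distrC; exact: H.
move=> /andP[a0 aW] /andP[b0 bW].
rewrite !ger0_norm ?subr_ge0 ?lerXn2r ?nnegrE //.
apply: le_trans (subrX_le n _) _; first by rewrite b0.
rewrite ler_wpM2r ?subr_ge0 // ler_wpM2l // lerXn2r ?nnegrE //; exact: le_trans aW.
Qed.

Unset Implicit Arguments.

Theorem theorem3p6 (R : realType) (n : nat) (f v : 'rV[R]_n -> R)
    (vh : R -> 'rV[R]_n -> R) :
  (1 <= n)%N ->
  {within unit_cube, continuous f} ->
  (forall x, unit_cube x -> 0 <= f x) ->
  (forall h : R, 0 < h -> S2_maximal_solution f h (vh h)) ->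
  P2_maximal_viscosity_solution f v ->
  grid_error h (vh h) v @[h --> 0^'+] --> 0.
Proof.
move=> n1 cf f0 Sh [u [uS um vE]].
have [uc uG uV] := uS.
have np : 0 < n%:R :> R by rewrite ltr0n.
have c0 : @unit_cube R n 0 by move=> i; rewrite mxE lexx ler01.
have [M fM] := cube_bounded cf.
have [U uU] := cube_bounded uc.
have u0 := nondecreasing_ge0 n1 uG um.
have M0 : 0 <= M by exact: le_trans (f0 _ c0) (fM _ c0).
have U0 : 0 <= U by exact: le_trans (u0 _ c0) (uU _ c0).
have rM0 := @rootn_ge0 R n M.
pose W := n%:R * rootn n M + U.
have uW x : unit_cube x -> u x <= W.
  by move=> /uU /le_trans; apply; rewrite lerDr mulr_ge0 // ltW.
have W0 : 0 <= W by rewrite addr_ge0 // mulr_ge0 // ltW.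
apply/cvgrPdist_lt => r r0.
pose L := n%:R * W ^+ n.-1 + 1.
have L0 : 0 < L by rewrite ltr_wpDl // mulr_ge0 ?exprn_ge0 // ltW.
(* Both comparisons give an error [s + n * e = 2 * s] for the roots; passing to
   n-th powers multiplies it by at most [L]. *)
pose s := r / (4 * L).
have s0 : 0 < s by rewrite divr_gt0 // mulr_gt0.
pose e := s / n%:R.
have e0 : 0 < e by rewrite divr_gt0.
have E0 : 0 < e ^+ n by rewrite exprn_gt0.
have E2 : 0 < e ^+ n / 2 by rewrite divr_gt0.
have [d1 d10 d1P] := cube_unif_continuous cf E2.
have [d2 d20 d2P] := cube_unif_continuous uc s0.
have sn0 : 0 < (s / n%:R) ^+ n by [].
pose d := Num.min (Num.min d1 d2) ((s / n%:R) ^+ n / (M + 1)).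
have M1 : 0 < M + 1 by rewrite ltr_wpDl.
have d0 : 0 < d by rewrite !lt_min d10 d20 divr_gt0.
have dd1 : d <= d1 by rewrite !ge_min lexx.
have dd2 : d <= d2 by rewrite !ge_min lexx orbT.
have Md : M * d < (s / n%:R) ^+ n.
  apply: lt_le_trans (_ : (M + 1) * d <= _); first by rewrite ltr_pM2r // ltrDl.
  by rewrite mulrC -ler_pdivlMr // ge_min lexx orbT.
have f_mod x y : unit_cube x -> unit_cube y ->
  (forall i, `|x 0 i - y 0 i| < d) -> `|f x - f y| < e ^+ n / 2.
  by move=> cx cy xy; apply: d1P => // i; exact: lt_le_trans (xy i) dd1.
have u_mod x y : unit_cube x -> unit_cube y ->
  (forall i, `|x 0 i - y 0 i| < d) -> `|u x - u y| < s.
  by move=> cx cy xy; apply: d2P => // i; exact: lt_le_trans (xy i) dd2.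
have dd : 0 < d ^+ 2 by rewrite exprn_gt0.
pose k := (W + 1) / d ^+ 2.
have k0 : 0 < k by rewrite divr_gt0 // ltr_wpDl.
have Wk : W < k * d ^+ 2 by rewrite divfK ?(gt_eqF dd) // ltrDl.
have N1 : 1 <= (n * n)%:R :> R by rewrite ler1n muln_gt0 n1.
have ME : 0 < M + e ^+ n by rewrite ltr_wpDl.
pose t := e ^+ n / (2 * ((n * n)%:R * (M + e ^+ n))).
have NME : 0 < (n * n)%:R * (M + e ^+ n) by rewrite mulr_gt0 // (lt_le_trans ltr01).
have t0 : 0 < t by rewrite divr_gt0 // mulr_gt0.
have t1 : t <= 1.
  have MN : M + e ^+ n <= (n * n)%:R * (M + e ^+ n) by rewrite ler_peMl // ltW.
  rewrite ler_pdivrMr; last exact: mulr_gt0.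
  by move: M0 E0; lra.
have t01 : 0 <= t <= 1 by rewrite (ltW t0).
have tE : (n * n)%:R * t * (M + e ^+ n) <= e ^+ n / 2.
  rewrite le_eqVlt; apply/orP; left; apply/eqP; rewrite /t; field.
  by rewrite !gt_eqF ?ltr0n ?muln_gt0 ?n1 // (lt_le_trans ltr01).
have k20 : 0 < 2 * k by rewrite mulr_gt0.
near=> h.
have h0 : 0 < h by near: h; exact: nbhs_right_gt.
have hs : 2 * k * h <= t * s.
  rewrite mulrC -ler_pdivlMr //; near: h.
  by apply: nbhs_right_le; rewrite divr_gt0 // mulr_gt0.
have he : k * h <= t * e.
  rewrite mulrC -ler_pdivlMr //; near: h.
  by apply: nbhs_right_le; rewrite divr_gt0 // mulr_gt0.
have Sg := Sh h h0.
have g0 x : grid h x -> 0 <= vh h x by exact: (S2_sol_ge0 n1 h0 f0 Sg).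
have gW x : grid h x -> n%:R * rootn n (vh h x) <= W.
  move=> gx; apply: le_trans (_ : n%:R * rootn n M <= _); last by rewrite lerDl.
  rewrite ler_pM2l // le_rootn // g0 //=.
  apply: le_trans (S2_sol_le_prod n1 h0 f0 Sg fM gx) _.
  by rewrite ler_piMr // prodr_ile1 // => i _; exact: gx.1.
have err x : grid h x -> `|vh h x - v x| <= L * (2 * s).
  move=> gx; have cx := gx.1.
  have A := scheme_le_viscosity n1 f0 uS um s0 e0 d0 k0 h0 t01 Sg fM gW f_mod Md Wk tE hs he gx.
  have B := viscosity_le_scheme n1 f0 uS s0 e0 d0 k0 h0 t01 Sg fM uW f_mod u_mod Wk tE he gx.
  have ne : n%:R * e = s by rewrite /e mulrC divfK // gt_eqF.
  rewrite ne in A B.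
  have wu : `|n%:R * rootn n (vh h x) - u x| <= 2 * s.
    by rewrite ler_norml; apply/andP; split; lra.
  rewrite (vE _ cx) -[vh h x in X in X <= _](rootnK n1 (g0 x gx)) -expr_div_n.
  have Wn : W / n%:R <= W by rewrite ler_pdivrMr // ler_peMr // ler1n.
  have aW : 0 <= rootn n (vh h x) <= W.
    rewrite rootn_ge0 /=; apply: le_trans Wn; rewrite ler_pdivlMr // mulrC; exact: gW.
  have bW : 0 <= u x / n%:R <= W.
    rewrite divr_ge0 ?u0 ?(ltW np) //=; apply: le_trans Wn.
    by rewrite ler_pM2r ?invr_gt0 // uW.
  apply: le_trans (normrX_sub_le n aW bW) _.
  apply: ler_pM => //.
  - by rewrite mulr_ge0 ?exprn_ge0 // ltW.
  - by rewrite lerDl.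
  apply: le_trans wu.
  have -> : n%:R * rootn n (vh h x) - u x = n%:R * (rootn n (vh h x) - u x / n%:R).
    by field; rewrite gt_eqF.
  by rewrite normrM ger0_norm ?(ltW np) // ler_peMl // ler1n.
have L2 : L * (2 * s) < r.
  have -> : L * (2 * s) = r / 2 by rewrite /s; field; rewrite gt_eqF.
  by rewrite ltr_pdivrMr // ltr_pMr // ltr1n.
have gz : grid h (0 : 'rV[R]_n) by split; [exact: c0|move=> i; exists 0; rewrite mxE mulr0z mulr0].
have sup_le : grid_error h (vh h) v <= L * (2 * s).
  apply: ge_sup; first by exists `|vh h 0 - v 0|; exists 0.
  by move=> _ [x gx <-]; exact: err.
have sup_ge : 0 <= grid_error h (vh h) v.
  apply: le_trans (normr_ge0 (vh h 0 - v 0)) _; apply: ub_le_sup; last by exists 0.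
  by exists (L * (2 * s)) => _ [x gx <-]; exact: err.
by rewrite sub0r normrN ger0_norm // (le_lt_trans sup_le).
Unshelve. all: by end_near.
Qed.
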